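(* Let $\alpha\ge 1$ and $\beta\ge \frac{3+\sqrt{17}}{2}$ be real numbers, and let $m\ge 0$ be an integer. Then for every $z\in\mathcal{U}$, $$\Re\left\{\frac{\mathbb{E}'_{\alpha,\beta}(z)}{(\mathbb{E}_{\alpha,\beta})'_m(z)}\right\}\ge\frac{\beta^2-3\beta-2}{\beta^2}$$ and $$\Re\left\{\frac{(\mathbb{E}_{\alpha,\beta})'_m(z)}{\mathbb{E}'_{\alpha,\beta}(z)}\right\}\ge\frac{\beta^2}{\beta^2+3\beta+2}.$$
   Context: $\mathcal{U}=\{z\in\mathbb{C}:|z|<1\}$ is the open unit disk and $\Gamma$ is the Gamma function. For $\alpha>0$, $\beta>0$ the normalized Mittag-Leffler function is $$\mathbb{E}_{\alpha,\beta}(z)=z+\sum_{n=1}^\infty A_n z^{n+1},\qquad A_n=\frac{\Gamma(\beta)}{\Gamma(\alpha n+\beta)},\quad z\in\mathcal{U}.$$ Its partial sums are $(\mathbb{E}_{\alpha,\beta})_0(z)=z$ and $(\mathbb{E}_{\alpha,\beta})_m(z)=z+\sum_{n=1}^m A_n z^{n+1}$ for integers $m\ge 1$. Primes denote derivatives with respect to $z$; $(\mathbb{E}_{\alpha,\beta})'_m$ is the derivative of the partial sum $(\mathbb{E}_{\alpha,\beta})_m$. *)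

(* Defs.v *)
From Stdlib Require Import Reals.
From Coquelicot Require Import Coquelicot.

Open Scope R_scope.

(** Euler's integral; it converges, and so defines [Gamma x], for [0 < x]. *)
Definition Gamma (x : R) : R :=
  RInt_gen (fun t : R => Rpower t (x - 1) * exp (- t))
    (at_right 0) (Rbar_locally p_infty).

(** Coquelicot's [Series] is for real series only.  This is the sum of a complex
    series, meaningful when the series converges ([C_Series_unique]). *)
Definition C_Series (a : nat -> C) : C :=
  iota (T := C_CompleteNormedModule) (fun l : C => is_series a l).

Lemma C_Series_unique (a : nat -> C) (l : C) :
  is_series a l -> C_Series a = l.
Proof.
intros H.
apply (iota_filterlim_locally (V := C_CompleteNormedModule)).
exact H.
Qed.

Definition ML_coef (alpha beta : R) (n : nat) : R :=
  Gamma beta / Gamma (alpha * INR n + beta).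

Definition ML_term (alpha beta : R) (z : C) (n : nat) : C :=
  (RtoC (ML_coef alpha beta n) * z ^ (n + 1))%C.

(** The sum over [n >= 1] is shifted, as series are indexed from [0]. *)
Definition ML (alpha beta : R) (z : C) : C :=
  (z + C_Series (fun k : nat => ML_term alpha beta z (S k)))%C.

(** For [m = 0] the range [1..m] is empty and the sum is [0]. *)
Definition ML_partial (alpha beta : R) (m : nat) (z : C) : C :=
  (z + sum_n_m (ML_term alpha beta z) 1 m)%C.

(* Main.v *)
Require Import Defs.
From Stdlib Require Import Reals Lra Lia.
From Coquelicot Require Import Coquelicot.

(** Write [A n] for the coefficients, [P] for the derivative of the partial sum
    at [z], and [T] for the rest of the derivative series, so that the two
    quotients are [(P + T) / P] and [P / (P + T)].  Both are governed by
    [w = T / P]: the first is [1 + w], the second is [1 / (1 + w)], and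
    [|w| <= sigma] gives the real parts at least [1 - sigma] and
    [1 / (1 + sigma)].  These are the two bounds claimed, with
    [sigma = (3 beta + 2) / beta ^ 2]; the hypothesis on [beta] says exactly that
    [sigma <= 1].

    To bound [w], let [s] and [t] be the sums of [(n + 1) A n] over
    [1 <= n <= m] and over [n > m].  Then [|P - 1| <= s] and [|T| <= t], so
    [|w| <= t / (1 - s)], which is below [sigma] as soon as [s + t < sigma <= 1]
    ([quotient_Re_bounds]).  It remains to see that the whole sum of
    [(n + 1) A n] over [n >= 1] is below [sigma].  Since [Gamma] increases for
    arguments at least 2 and [Gamma (x + 1) = x Gamma x], one has
    [A (n + 1) <= 1 / (beta (beta + 1) ^ n)] ([ML_coef_bounds]), and the weighted
    sum of this majorant telescopes to
    [(2 beta ^ 2 + 3 beta + 1) / beta ^ 3 < sigma] ([sum_n_weighted_le]).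

    Two pieces of analysis support this.  The facts on [Gamma] come from Euler's
    integral: comparing integrands with [(c + s (t - 1)) exp (- t)], whose
    integral is [c], gives both monotonicity and a positive lower bound.
    Term-by-term differentiation of the series rests on the estimate
    [|w^(n+1) - z^(n+1) - (n+1) z^n (w - z)| <= (n+1)^2 |w - z|^2] on the closed
    unit disk: as [(n+1)^2 A n] is summable, the series differs from its
    linearization by [O(|w - z|^2)] ([is_C_derive_power_series]). *)

Open Scope R_scope.

(** * Improper integrals over the half line *)

Local Notation is_half_line_integral f :=
  (is_RInt_gen f (at_right 0) (Rbar_locally p_infty)).

(** For properties of a pair of endpoints that follow from [0 < a < 1 < b]; in
    particular [a <= b], which removes the [Rmin] and [Rmax] from integrals. *)
Lemma half_line_endpoints (P : R * R -> Prop) :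
  (forall a b, 0 < a < 1 -> 1 < b -> P (a, b)) ->
  filter_prod (at_right 0) (Rbar_locally p_infty) P.
Proof.
intros H.
apply (Filter_prod _ _ _ (fun a => 0 < a < 1) (fun b => 1 < b)).
- exists (mkposreal 1 Rlt_0_1). intros a Ha Ha0.
  change (Rabs (a - 0) < 1) in Ha. apply Rabs_lt_between in Ha. lra.
- exists 1. intros b Hb. exact Hb.
- exact H.
Qed.

Lemma RInt_subinterval_le (f : R -> R) (a a0 b0 b : R) :
  (forall t, 0 < t -> continuous f t) -> (forall t, 0 < t -> 0 <= f t) ->
  0 < a -> a <= a0 -> a0 <= b0 -> b0 <= b ->
  RInt f a0 b0 <= RInt f a b.
Proof.
intros Hc Hp Ha H1 H2 H3.
assert (Hex : forall u v, 0 < u -> u <= v -> ex_RInt f u v).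
{ intros u v Hu Huv. apply (ex_RInt_continuous (V := R_CompleteNormedModule)).
  intros t Ht. rewrite Rmin_left in Ht by lra. apply Hc. lra. }
assert (Hge : forall u v, 0 < u -> u <= v -> 0 <= RInt f u v).
{ intros u v Hu Huv. apply RInt_ge_0; [exact Huv | apply Hex; assumption |].
  intros t Ht. apply Hp. lra. }
rewrite <- (RInt_Chasles f a a0 b) by (apply Hex; lra).
rewrite <- (RInt_Chasles f a0 b0 b) by (apply Hex; lra).
change plus with Rplus.
pose proof (Hge a a0 ltac:(lra) ltac:(lra)).
pose proof (Hge b0 b ltac:(lra) ltac:(lra)).
lra.
Qed.

(** The integrals of a nonnegative function increase with the interval, so they
    converge to their supremum. *)
Lemma ex_half_line_integral_of_bounded (f : R -> R) (M : R) :
  (forall t, 0 < t -> continuous f t) -> (forall t, 0 < t -> 0 <= f t) ->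
  (forall a b, 0 < a -> a <= b -> RInt f a b <= M) ->
  exists l, is_half_line_integral f l.
Proof.
intros Hc Hp HM.
(* Endpoints are kept on either side of 1 so that any two of the intervals
   compared below overlap. *)
set (E := fun y => exists a b, 0 < a < 1 /\ 1 < b /\ y = RInt f a b).
destruct (completeness E) as [l [Hub Hlub]].
- exists M. intros y (a & b & Ha & Hb & ->). apply HM; lra.
- exists (RInt f (1/2) 2), (1/2), 2. repeat split; lra.
- exists l.
  intros P [eps HP].
  assert (Hex : exists a0 b0, 0 < a0 < 1 /\ 1 < b0 /\ l - eps < RInt f a0 b0).
  { apply Classical_Prop.NNPP. intros Hn.
    assert (Hle : l <= l - eps).
    { apply Hlub. intros y (a & b & Ha & Hb & ->).
      apply Rnot_lt_le. intros Hlt. apply Hn. exists a, b. auto. }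
    pose proof (cond_pos eps). lra. }
  destruct Hex as (a0 & b0 & Ha0 & Hb0 & Hlt).
  apply (Filter_prod _ _ _ (fun a => 0 < a < a0) (fun b => b0 < b)).
  + exists (mkposreal a0 (proj1 Ha0)). intros a Ha Hpos.
    change (Rabs (a - 0) < a0) in Ha. apply Rabs_lt_between in Ha. lra.
  + exists b0. intros b Hb. exact Hb.
  + intros a b Ha Hb. simpl.
    exists (RInt f a b). split.
    * apply (RInt_correct (V := R_CompleteNormedModule)).
      apply (ex_RInt_continuous (V := R_CompleteNormedModule)).
      intros t Ht. rewrite Rmin_left in Ht by lra. apply Hc. lra.
    * apply HP. change (Rabs (RInt f a b - l) < eps).
      apply Rabs_lt_between. split.
      -- pose proof (RInt_subinterval_le f a a0 b0 b Hc Hp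
           ltac:(lra) ltac:(lra) ltac:(lra) ltac:(lra)). lra.
      -- assert (RInt f a b <= l).
         { apply Hub. exists a, b. repeat split; lra. }
         pose proof (cond_pos eps). lra.
Qed.

Lemma is_half_line_integral_derive (F f : R -> R) (l0 l1 : R) :
  (forall t, 0 < t -> is_derive F t (f t)) ->
  (forall t, 0 < t -> continuous f t) ->
  filterlim F (at_right 0) (locally l0) ->
  filterlim F (Rbar_locally p_infty) (locally l1) ->
  is_half_line_integral f (l1 - l0).
Proof.
intros HF Hf H0 H1.
apply (is_RInt_gen_ext (Derive F)).
- apply half_line_endpoints. intros a b Ha Hb t Ht. simpl in Ht.
  rewrite Rmin_left in Ht by lra. apply is_derive_unique, HF. lra.
- apply is_RInt_gen_Derive; [| | exact H0 | exact H1];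
    apply half_line_endpoints; intros a b Ha Hb t Ht; simpl in Ht;
    rewrite Rmin_left in Ht by lra.
  + exists (f t). apply HF. lra.
  + apply (continuous_ext_loc _ f); [| apply Hf; lra].
    exists (mkposreal t ltac:(lra)). intros u Hu.
    change (Rabs (u - t) < t) in Hu. apply Rabs_lt_between in Hu.
    symmetry. apply is_derive_unique, HF. lra.
Qed.

(** Obtained from the norm inequality for improper integrals with [g - f] as its
    own majorant: [|lg - lf| <= lg - lf]. *)
Lemma half_line_integral_le (f g : R -> R) (lf lg : R) :
  is_half_line_integral f lf -> is_half_line_integral g lg ->
  (forall t, 0 < t -> f t <= g t) -> lf <= lg.
Proof.
intros Hf Hg Hfg.
pose proof (is_RInt_gen_minus g f lg lf Hg Hf) as H.
assert (Habs : norm (minus lg lf) <= minus lg lf).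
{ apply (RInt_gen_norm (Fa := at_right 0) (Fb := Rbar_locally p_infty)
           (fun t => minus (g t) (f t)) (fun t => minus (g t) (f t)));
    [| | exact H | exact H]; apply half_line_endpoints; intros a b Ha Hb; simpl.
  - lra.
  - intros t Ht. change (Rabs (g t - f t) <= g t - f t).
    rewrite Rabs_pos_eq; [lra |]. specialize (Hfg t). lra. }
change (Rabs (lg - lf) <= lg - lf) in Habs.
pose proof (Rabs_pos (lg - lf)). lra.
Qed.

(** * The Gamma function *)

Lemma exp_nondecreasing (x y : R) : x <= y -> exp x <= exp y.
Proof.
intros [Hlt | ->]; [left; apply exp_increasing; exact Hlt | right; reflexivity].
Qed.

(** The tangent line of [ln] at [2 s] is what costs exactly half of the decay:
    [ln t <= t / (2 s) - 1 + ln (2 s)], multiplied by [s]. *)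
Lemma Rpower_exp_bound (s : R) : 0 < s ->
  exists C, 0 < C /\ forall t, 0 < t -> Rpower t s * exp (- t) <= C * exp (- (t / 2)).
Proof.
intros Hs.
exists (exp (s * (ln (2 * s) - 1))). split; [apply exp_pos |].
intros t Ht. unfold Rpower. rewrite <- !exp_plus.
assert (Hln : ln t <= t / (2 * s) - 1 + ln (2 * s)).
{ pose proof (exp_ineq1_le (ln (t / (2 * s)))) as H.
  assert (0 < t / (2 * s)) by (apply Rdiv_lt_0_compat; lra).
  rewrite exp_ln in H by assumption.
  unfold Rdiv in *. rewrite ln_mult in H by (try apply Rinv_0_lt_compat; lra).
  rewrite ln_Rinv in H by lra. lra. }
apply Rmult_le_compat_l with (r := s) in Hln; [| lra].
replace (s * (t / (2 * s) - 1 + ln (2 * s)))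
  with (t / 2 + s * (ln (2 * s) - 1)) in Hln by (field; lra).
apply exp_nondecreasing. lra.
Qed.

Lemma continuous_Rpower_exp (s t : R) : 0 < t ->
  continuous (fun u => Rpower u s * exp (- u)) t.
Proof.
intros Ht. apply (ex_derive_continuous (V := R_NormedModule)).
unfold Rpower. auto_derive. lra.
Qed.

Lemma filterlim_exp_decay (c : R) : 0 < c ->
  filterlim (fun t => exp (- (t * c))) (Rbar_locally p_infty) (locally 0).
Proof.
intros Hc.
apply (filterlim_comp _ _ _ (fun t => - (t * c)) exp _ (Rbar_locally m_infty)).
- intros P [N HN]. exists (- N / c). intros t Ht. apply HN.
  apply Rmult_lt_compat_r with (r := c) in Ht; [| exact Hc].
  replace (- N / c * c) with (- N) in Ht by (field; lra). lra.
- exact is_lim_exp_m.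
Qed.

Lemma filterlim_Rpower_exp_p_infty (s : R) : 0 < s ->
  filterlim (fun t => Rpower t s * exp (- t)) (Rbar_locally p_infty) (locally 0).
Proof.
intros Hs.
destruct (Rpower_exp_bound s Hs) as (C & HC & Hle).
apply (filterlim_le_le (fun _ => 0) _ (fun t => C * exp (- (t * / 2))) (Finite 0)).
- exists 0. intros t Ht. split.
  + apply Rmult_le_pos; left; apply exp_pos.
  + apply Hle. exact Ht.
- apply filterlim_const.
- change (filterlim (fun t => C * exp (- (t * / 2))) (Rbar_locally p_infty) (locally 0)).
  rewrite <- (Rmult_0_r C).
  apply (filterlim_comp _ _ _ (fun t => exp (- (t * / 2))) (fun y => C * y) _ (locally 0)).
  + apply filterlim_exp_decay. lra.
  + apply (filterlim_scal_r (K := R_AbsRing) (V := R_NormedModule) C 0).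
Qed.

Lemma filterlim_Rpower_exp_0 (s : R) : 0 < s ->
  filterlim (fun t => Rpower t s * exp (- t)) (at_right 0) (locally 0).
Proof.
intros Hs.
apply (filterlim_le_le (fun _ => 0) _ (fun t => Rpower t s) (Finite 0)).
- exists (mkposreal 1 Rlt_0_1). intros t _ Ht. split.
  + apply Rmult_le_pos; left; apply exp_pos.
  + rewrite <- (Rmult_1_r (Rpower t s)) at 2.
    apply Rmult_le_compat_l; [left; apply exp_pos |].
    rewrite <- exp_0. left. apply exp_increasing. lra.
- apply filterlim_const.
- simpl. unfold Rpower.
  apply (filterlim_comp _ _ _ (fun t => s * ln t) exp _ (Rbar_locally m_infty)).
  + intros P [N HN].
    destruct (is_lim_ln_0 (fun y => y < N / s)) as [eps Heps].
    { exists (N / s). auto. }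
    exists eps. intros t Ht Ht0. apply HN.
    specialize (Heps t Ht Ht0).
    apply Rmult_lt_compat_l with (r := s) in Heps; [| exact Hs].
    replace (s * (N / s)) with N in Heps by (field; lra). exact Heps.
  + exact is_lim_exp_m.
Qed.

Lemma Gamma_integral (x : R) : 1 < x ->
  is_half_line_integral (fun t => Rpower t (x - 1) * exp (- t)) (Gamma x).
Proof.
intros Hx.
apply (RInt_gen_correct (V := R_CompleteNormedModule)).
destruct (Rpower_exp_bound (x - 1)) as (C & HC & Hle); [lra |].
apply (ex_half_line_integral_of_bounded _ (2 * C)).
- intros t Ht. apply continuous_Rpower_exp, Ht.
- intros t Ht. apply Rmult_le_pos; left; apply exp_pos.
- intros a b Ha Hab.
  assert (HI : is_RInt (fun t => C * exp (- (t / 2))) a b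
                 (- 2 * C * exp (- (b / 2)) - - 2 * C * exp (- (a / 2)))).
  { apply (is_RInt_derive (V := R_CompleteNormedModule) (fun t => - 2 * C * exp (- (t / 2)))).
    - intros t _. auto_derive; [trivial | unfold Rdiv; field].
    - intros t _. apply (ex_derive_continuous (V := R_NormedModule)).
      auto_derive. trivial. }
  apply Rle_trans with (RInt (fun t => C * exp (- (t / 2))) a b).
  + apply RInt_le; [exact Hab | | eexists; exact HI | intros t Ht; apply Hle; lra].
    apply (ex_RInt_continuous (V := R_CompleteNormedModule)).
    intros t Ht. rewrite Rmin_left in Ht by lra. apply continuous_Rpower_exp. lra.
  + rewrite (is_RInt_unique _ _ _ _ HI).
    assert (exp (- (a / 2)) <= 1).
    { rewrite <- exp_0. left. apply exp_increasing. lra. }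
    pose proof (exp_pos (- (b / 2))). nra.
Qed.

(** Integration by parts: [x t^(x-1) exp(-t) - t^x exp(-t)] is the derivative of
    [t^x exp(-t)], which vanishes at both ends of the half line. *)
Lemma Gamma_succ (x : R) : 1 < x -> Gamma (x + 1) = x * Gamma x.
Proof.
intros Hx.
pose proof (Gamma_integral (x + 1) ltac:(lra)) as H1.
replace (x + 1 - 1) with x in H1 by ring.
pose proof (is_RInt_gen_scal _ x _ (Gamma_integral x Hx)) as H2.
pose proof (is_RInt_gen_minus _ _ _ _ H2 H1) as H3.
assert (H4 : is_half_line_integral
   (fun t => x * (Rpower t (x - 1) * exp (- t)) - Rpower t x * exp (- t)) (0 - 0)).
{ apply (is_half_line_integral_derive (fun t => Rpower t x * exp (- t))).
  - intros t Ht.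
    assert (E : Rpower t (x - 1) = Rpower t x / t).
    { unfold Rminus. rewrite Rpower_plus, Rpower_Ropp, Rpower_1 by exact Ht. reflexivity. }
    rewrite E. unfold Rpower. auto_derive; [lra | field; lra].
  - intros t Ht. apply (ex_derive_continuous (V := R_NormedModule)).
    unfold Rpower. auto_derive. lra.
  - apply filterlim_Rpower_exp_0. lra.
  - apply filterlim_Rpower_exp_p_infty. lra. }
pose proof (is_RInt_gen_unique (V := R_CompleteNormedModule) _ _ H3) as E3.
pose proof (is_RInt_gen_unique (V := R_CompleteNormedModule) _ _ H4) as E4.
change (RInt_gen (fun t => x * (Rpower t (x - 1) * exp (- t)) - Rpower t x * exp (- t))
         (at_right 0) (Rbar_locally p_infty) = x * Gamma x - Gamma (x + 1)) in E3.
rewrite E4 in E3. lra.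
Qed.

(** These are the comparison functions for [Gamma]: the term in [s] shifts the
    integrand without changing the integral.  An antiderivative is
    [- (c + s t) exp(-t)]. *)
Lemma half_line_integral_linear_exp (c s : R) :
  is_half_line_integral (fun t => (c + s * (t - 1)) * exp (- t)) c.
Proof.
enough (H : is_half_line_integral (fun t => (c + s * (t - 1)) * exp (- t)) (0 - - c))
  by (replace (0 - - c) with c in H by ring; exact H).
apply (is_half_line_integral_derive (fun t => - (c + s * t) * exp (- t))).
- intros t Ht. auto_derive; [trivial | ring].
- intros t Ht. apply (ex_derive_continuous (V := R_NormedModule)). auto_derive. trivial.
- replace (- c) with (- (c + s * 0) * exp (- 0)) by (rewrite Ropp_0, exp_0; ring).
  apply (filterlim_filter_le_1 (F := locally 0) (fun t => - (c + s * t) * exp (- t))).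
  + intros P [eps HP]. exists eps. intros t Ht _. apply HP, Ht.
  + apply (ex_derive_continuous (V := R_NormedModule)
             (fun t => - (c + s * t) * exp (- t)) 0). auto_derive. trivial.
- apply (filterlim_ext_loc
    (fun t => plus (scal (- c) (exp (- (t * 1)))) (scal (- s) (Rpower t 1 * exp (- t))))).
  + exists 0. intros t Ht. rewrite Rpower_1 by exact Ht. rewrite Rmult_1_r.
    change (- c * exp (- t) + - s * (t * exp (- t)) = - (c + s * t) * exp (- t)). ring.
  + replace 0 with (plus (scal (- c) 0) (scal (- s) 0))
      by (change (- c * 0 + - s * 0 = 0); ring).
    eapply filterlim_comp_2; [| | apply (filterlim_plus (V := R_NormedModule))].
    * eapply filterlim_comp; [apply filterlim_exp_decay; lra |].
      apply (filterlim_scal_r (K := R_AbsRing) (V := R_NormedModule)).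
    * eapply filterlim_comp; [apply filterlim_Rpower_exp_p_infty; lra |].
      apply (filterlim_scal_r (K := R_AbsRing) (V := R_NormedModule)).
Qed.

(** The function [a |-> t^a] is convex, so its chord over [a, b] is at least as
    steep as its chord over [0, 1], whose slope is [t - 1]. *)
Lemma Rpower_slope_ge (t a b : R) : 0 < t -> 1 <= a <= b ->
  Rpower t a + (b - a) * (t - 1) <= Rpower t b.
Proof.
intros Ht Hab.
pose proof (exp_ineq1_le ((b - a) * ln t)) as H1.
replace b with (a + (b - a)) at 2 by ring.
rewrite Rpower_plus. unfold Rpower at 3.
assert (Hln : t - 1 <= Rpower t a * ln t).
{ assert (Hta : Rpower t a = t * exp ((a - 1) * ln t)).
  { replace a with (1 + (a - 1)) at 1 by ring.
    rewrite Rpower_plus, Rpower_1 by exact Ht. reflexivity. }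
  assert (Htln : t - 1 <= t * ln t).
  { pose proof (exp_ineq1_le (- ln t)) as H.
    rewrite exp_Ropp, exp_ln in H by exact Ht.
    apply Rmult_le_compat_l with (r := t) in H; [| lra].
    rewrite Rinv_r in H by lra. lra. }
  assert (Hm : t * ln t <= Rpower t a * ln t).
  { rewrite Hta, Rmult_assoc. apply Rmult_le_compat_l; [lra |].
    pose proof (exp_ineq1_le ((a - 1) * ln t)) as H.
    destruct (Rle_dec 0 (ln t)) as [Hl | Hl].
    - assert (1 <= exp ((a - 1) * ln t)) by nra. nra.
    - assert (exp ((a - 1) * ln t) <= 1).
      { rewrite <- exp_0 at 2. apply exp_nondecreasing. nra. }
      nra. }
  lra. }
assert (0 < Rpower t a) by apply exp_pos.
apply Rle_trans with (Rpower t a * (1 + (b - a) * ln t)).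
- rewrite Rmult_plus_distr_l, Rmult_1_r. nra.
- apply Rmult_le_compat_l; [lra | exact H1].
Qed.

(** The integrand for [y] dominates the one for [x] plus
    [(y - x) (t - 1) exp(-t)], and the added term has integral 0. *)
Lemma Gamma_increasing (x y : R) : 2 <= x <= y -> Gamma x <= Gamma y.
Proof.
intros Hxy.
pose proof (is_RInt_gen_plus (Fa := at_right 0) (Fb := Rbar_locally p_infty) _ _ _ _
  (Gamma_integral x ltac:(lra))
              (half_line_integral_linear_exp 0 (y - x))) as H.
replace (Gamma x) with (plus (Gamma x) 0) by (change (Gamma x + 0 = Gamma x); ring).
apply (half_line_integral_le _ _ _ _ H (Gamma_integral y ltac:(lra))).
intros t Ht.
change (Rpower t (x - 1) * exp (- t) + (0 + (y - x) * (t - 1)) * exp (- t)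
          <= Rpower t (y - 1) * exp (- t)).
rewrite <- Rmult_plus_distr_r.
apply Rmult_le_compat_r; [left; apply exp_pos |].
pose proof (Rpower_slope_ge t (x - 1) (y - 1) Ht ltac:(lra)). nra.
Qed.

(** By the tangent bound [1 + (x - 1) (t - 1) <= t^(x-1)]. *)
Lemma Gamma_ge_1 (x : R) : 2 <= x -> 1 <= Gamma x.
Proof.
intros Hx.
apply (half_line_integral_le _ _ _ _ (half_line_integral_linear_exp 1 (x - 1))
         (Gamma_integral x ltac:(lra))).
intros t Ht.
apply Rmult_le_compat_r; [left; apply exp_pos |].
pose proof (Rpower_slope_ge t 1 (x - 1) Ht ltac:(lra)) as H.
rewrite Rpower_1 in H by exact Ht. nra.
Qed.

Lemma Gamma_shift_ge (x : R) (n : nat) : 2 <= x ->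
  x * (x + 1) ^ n * Gamma x <= Gamma (INR n + 1 + x).
Proof.
intros Hx. pose proof (Gamma_ge_1 x Hx) as HG.
induction n as [|n IH].
- simpl. replace (0 + 1 + x) with (x + 1) by ring.
  rewrite Gamma_succ by lra. lra.
- rewrite S_INR. pose proof (pos_INR n) as Hn.
  replace (INR n + 1 + 1 + x) with (INR n + 1 + x + 1) by ring.
  rewrite Gamma_succ by lra.
  pose proof (Gamma_ge_1 (INR n + 1 + x) ltac:(lra)).
  apply Rle_trans with ((x + 1) * Gamma (INR n + 1 + x)).
  + simpl. nra.
  + apply Rmult_le_compat_r; lra.
Qed.

Lemma ML_coef_0 (alpha beta : R) : 2 <= beta -> ML_coef alpha beta 0 = 1.
Proof.
intros Hb. unfold ML_coef. simpl. rewrite Rmult_0_r, Rplus_0_l.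
apply Rinv_r. pose proof (Gamma_ge_1 beta Hb). lra.
Qed.

Lemma ML_coef_bounds (alpha beta : R) (n : nat) :
  1 <= alpha -> 2 <= beta ->
  0 <= ML_coef alpha beta (S n) <= 1 / (beta * (beta + 1) ^ n).
Proof.
intros Ha Hb. unfold ML_coef.
pose proof (pos_INR n) as Hn.
pose proof (Gamma_ge_1 beta Hb) as HG.
pose proof (Gamma_shift_ge beta n Hb) as H1.
pose proof (Gamma_increasing (INR n + 1 + beta) (alpha * INR (S n) + beta)) as H2.
rewrite S_INR in *.
specialize (H2 ltac:(nra)).
assert (HP : 0 < beta * (beta + 1) ^ n).
{ apply Rmult_lt_0_compat; [lra | apply pow_lt; lra]. }
assert (Hpos : 0 < Gamma (alpha * (INR n + 1) + beta)) by nra.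
split; [left; apply Rdiv_lt_0_compat; lra |].
apply Rmult_le_reg_r with (Gamma (alpha * (INR n + 1) + beta)); [exact Hpos |].
apply Rmult_le_reg_r with (beta * (beta + 1) ^ n); [exact HP |].
replace (Gamma beta / Gamma (alpha * (INR n + 1) + beta) *
   Gamma (alpha * (INR n + 1) + beta) * (beta * (beta + 1) ^ n))
  with (beta * (beta + 1) ^ n * Gamma beta) by (field; lra).
replace (1 / (beta * (beta + 1) ^ n) * Gamma (alpha * (INR n + 1) + beta) *
   (beta * (beta + 1) ^ n)) with (Gamma (alpha * (INR n + 1) + beta)).
- lra.
- field. split; [apply pow_nonzero|]; lra.
Qed.
(** * Complex power series *)

Lemma is_C_derive_of_quadratic_error (f : C -> C) (z l : C) (K delta : R) :
  0 < delta ->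
  (forall w : C, Cmod (w - z) < delta ->
    Cmod (f w - f z - l * (w - z)) <= K * Cmod (w - z) ^ 2) ->
  is_derive f z l.
Proof.
intros Hdelta H.
split.
- apply (is_linear_scal_l (K := C_AbsRing) (V := C_NormedModule) l).
- intros x Hx.
  assert (Hzx : z = x)
    by apply (is_filter_lim_locally_unique (V := AbsRing_NormedModule C_AbsRing) z x Hx).
  subst x.
  intros eps.
  assert (HK : 0 < 1 + Rabs K) by (pose proof (Rabs_pos K); lra).
  assert (Hr : 0 < Rmin delta (eps / (1 + Rabs K))).
  { apply Rmin_pos; [exact Hdelta | apply Rdiv_lt_0_compat; [apply cond_pos | exact HK]]. }
  exists (mkposreal _ Hr).
  intros w Hw.
  change (Cmod (w - z) < Rmin delta (eps / (1 + Rabs K))) in Hw.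
  change (Cmod (f w - f z - (w - z) * l) <= eps * Cmod (w - z)).
  replace ((w - z) * l)%C with (l * (w - z))%C by ring.
  assert (Hw1 : Cmod (w - z) < delta) by (eapply Rlt_le_trans; [exact Hw | apply Rmin_l]).
  assert (Hw2 : Cmod (w - z) < eps / (1 + Rabs K))
    by (eapply Rlt_le_trans; [exact Hw | apply Rmin_r]).
  eapply Rle_trans; [apply (H w Hw1) |].
  pose proof (Cmod_ge_0 (w - z)) as H0.
  replace (K * Cmod (w - z) ^ 2) with ((K * Cmod (w - z)) * Cmod (w - z)) by ring.
  apply Rmult_le_compat_r; [exact H0 |].
  apply Rle_trans with ((1 + Rabs K) * Cmod (w - z)).
  + apply Rmult_le_compat_r; [exact H0 |]. pose proof (Rle_abs K). lra.
  + apply Rmult_lt_compat_l with (r := 1 + Rabs K) in Hw2; [| exact HK].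
    replace ((1 + Rabs K) * (eps / (1 + Rabs K))) with (pos eps) in Hw2
      by (field; lra).
    lra.
Qed.

Lemma Cmod_pow_le_1 (z : C) (n : nat) : Cmod z <= 1 -> Cmod (z ^ n) <= 1.
Proof.
intros Hz. rewrite Cmod_pow.
rewrite <- (pow1 n).
apply pow_incr. split; [apply Cmod_ge_0 | exact Hz].
Qed.

(** With [D n] the difference on the left,
    [D (n+1) = w D n + (n+1) z^n (w - z)^2]. *)
Lemma Cpow_linearization_error (z w : C) (n : nat) :
  Cmod z <= 1 -> Cmod w <= 1 ->
  Cmod (w ^ (n + 1) - z ^ (n + 1) - INR (n + 1) * z ^ n * (w - z))
    <= INR (n + 1) ^ 2 * Cmod (w - z) ^ 2.
Proof.
intros Hz Hw.
pose proof (Cmod_ge_0 (w - z)) as H0.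
induction n as [|n IH].
- simpl. replace (w * 1 - z * 1 - 1 * 1 * (w - z))%C with (RtoC 0) by ring.
  rewrite Cmod_0. nra.
- assert (E : (w ^ (S n + 1) - z ^ (S n + 1) - INR (S n + 1) * z ^ S n * (w - z))%C =
    (w * (w ^ (n + 1) - z ^ (n + 1) - INR (n + 1) * z ^ n * (w - z))
     + INR (n + 1) * z ^ n * ((w - z) * (w - z)))%C).
  { replace (S n + 1)%nat with (S (S n)) by lia.
    replace (n + 1)%nat with (S n) by lia.
    rewrite (S_INR (S n)). rewrite RtoC_plus. rewrite !Cpow_S. ring. }
  rewrite E.
  eapply Rle_trans; [apply Cmod_triangle |].
  rewrite !Cmod_mult, Cmod_R.
  rewrite (Rabs_pos_eq (INR (n + 1))) by apply pos_INR.
  pose proof (Cmod_pow_le_1 z n Hz) as Hzn.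
  pose proof (Cmod_ge_0 (z ^ n)) as Hzn0.
  pose proof (pos_INR (n + 1)) as Hn.
  replace (INR (S n + 1)) with (INR (n + 1) + 1)
    by (rewrite <- S_INR; f_equal).
  set (D := Cmod (w ^ (n + 1) - z ^ (n + 1) - INR (n + 1) * z ^ n * (w - z))) in *.
  assert (HD : 0 <= D) by apply Cmod_ge_0.
  pose proof (Cmod_ge_0 w) as Hw0.
  set (h := Cmod (w - z)) in *.
  set (N := INR (n + 1)) in *.
  assert (Cmod w * D <= D) by nra.
  assert (N * Cmod (z ^ n) * (h * h) <= N * (h * h)).
  { rewrite Rmult_assoc. apply Rmult_le_compat_l; [exact Hn |]. nra. }
  nra.
Qed.

Lemma is_series_Cmod_le (a : nat -> C) (l : C) (b : nat -> R) :
  is_series a l -> (forall n, Cmod (a n) <= b n) -> ex_series b ->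
  Cmod l <= Series b.
Proof.
intros Ha Hab Hb.
assert (H1 : is_lim_seq (fun n => Cmod (sum_n a n)) (Cmod l)).
{ apply (filterlim_comp _ _ _ (sum_n a) Cmod _ (locally l)).
  - exact Ha.
  - apply (filterlim_norm (V := C_NormedModule) l). }
assert (H2 : is_lim_seq (sum_n b) (Series b)) by apply (Series_correct b Hb).
change (Rbar_le (Cmod l) (Series b)).
refine (is_lim_seq_le _ _ _ _ _ H1 H2).
intros n.
eapply Rle_trans; [apply (norm_sum_n_m (V := C_NormedModule)) |].
apply sum_n_m_le. exact Hab.
Qed.

(** Summing the linearization errors of the terms bounds that of [f] by
    [K |w - z|^2], where [K] is the sum of [|a n| (n + 1)^2]. *)
Lemma is_C_derive_power_series (a : nat -> R) (f : C -> C) (z l : C) :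
  ex_series (fun n => Rabs (a n) * INR (n + 1) ^ 2) ->
  (forall w : C, Cmod w < 1 -> is_series (fun n => (a n * w ^ (n + 1))%C) (f w)) ->
  Cmod z < 1 ->
  is_series (fun n => (a n * INR (n + 1) * z ^ n)%C) l ->
  is_derive f z l.
Proof.
intros Hsum Hf Hz Hl.
apply (is_C_derive_of_quadratic_error f z l
         (Series (fun n => Rabs (a n) * INR (n + 1) ^ 2)) (1 - Cmod z)); [lra |].
intros w Hwz.
assert (Hw : Cmod w < 1).
{ replace w with (z + (w - z))%C by ring.
  eapply Rle_lt_trans; [apply Cmod_triangle | lra]. }
assert (HS : is_series
  (fun n => (a n * (w ^ (n + 1) - z ^ (n + 1) - INR (n + 1) * z ^ n * (w - z)))%C)
  (f w - f z - l * (w - z))%C).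
{ pose proof (is_series_scal (V := C_NormedModule) (w - z)%C _ _ Hl) as H1.
  pose proof (is_series_minus (V := C_NormedModule) _ _ _ _ (Hf w Hw) (Hf z Hz)) as H2.
  pose proof (is_series_minus (V := C_NormedModule) _ _ _ _ H2 H1) as H3.
  replace (f w - f z - l * (w - z))%C
    with (plus (plus (f w) (opp (f z)))
            (opp (scal (w - z)%C (l : C_NormedModule))) : C_NormedModule).
  - eapply is_series_ext; [| exact H3].
    intros n. change plus with Cplus. change opp with Copp. change scal with Cmult.
    simpl. ring.
  - change plus with Cplus. change opp with Copp. change scal with Cmult. simpl. ring. }
rewrite <- Series_scal_r.
apply (is_series_Cmod_le _ _ _ HS).
- intros n. rewrite Cmod_mult, Cmod_R, Rmult_assoc.
  apply Rmult_le_compat_l; [apply Rabs_pos |].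
  apply Cpow_linearization_error; lra.
- apply ex_series_scal_r. exact Hsum.
Qed.

(** * Real parts of the two quotients *)

(** With [u] the real part of [w] and [c = |w|], clearing denominators leaves
    [(c - u) (1 - c) >= 0]. *)
Lemma Re_inv_one_plus_ge (w : C) :
  Cmod w < 1 -> 1 / (1 + Cmod w) <= Re (/ (1 + w))%C.
Proof.
intros Hw.
pose proof (Cmod_ge_0 w) as H0.
pose proof (Cmod2_alt w) as H2.
pose proof (re_le_Cmod w) as H3.
apply Rabs_le_between in H3.
destruct w as [u v]. unfold Re, Im in *. simpl in H2, H3.
set (c := Cmod (u, v)) in *.
simpl.
set (d := (1 + u) * ((1 + u) * 1) + (0 + v) * ((0 + v) * 1)).
assert (Hd : d = 1 + 2 * u + c * c) by (unfold d; nra).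
assert (Hp : 0 < d) by nra.
apply Rmult_le_reg_r with (1 + c); [lra |].
apply Rmult_le_reg_r with d; [exact Hp |].
replace (1 / (1 + c) * (1 + c) * d) with d by (field; lra).
replace ((1 + u) / d * (1 + c) * d) with ((1 + u) * (1 + c)) by (field; lra).
nra.
Qed.

(** The argument runs through [w = T / P]: from [t < sigma - s] and [sigma <= 1]
    follows [t < sigma (1 - s)], hence [|w| < sigma]. *)
Lemma quotient_Re_bounds (P T : C) (s t sigma : R) :
  Cmod (P - 1) <= s -> Cmod T <= t -> s + t < sigma -> sigma <= 1 ->
  1 - sigma <= Re ((P + T) / P)%C /\ 1 / (1 + sigma) <= Re (P / (P + T))%C.
Proof.
intros Hs Ht Hst Hsig.
assert (HP : 1 - s <= Cmod P).
{ pose proof (Cmod_triangle P (- (P - 1))) as H.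
  rewrite Cmod_opp in H.
  replace (P + - (P - 1))%C with (RtoC 1) in H by ring.
  rewrite Cmod_1 in H. lra. }
pose proof (Cmod_ge_0 (P - 1)) as Hs0.
pose proof (Cmod_ge_0 T) as Ht0.
assert (HP0 : P <> 0%C) by (apply Cmod_gt_0; lra).
set (w := (T / P)%C).
assert (Hw : Cmod w < sigma).
{ unfold w. rewrite Cmod_div by exact HP0.
  apply Rmult_lt_reg_r with (Cmod P); [lra |].
  unfold Rdiv. rewrite Rmult_assoc, Rinv_l by lra. nra. }
assert (Hw1 : (1 + w)%C <> 0%C).
{ intros E. assert (Ew : w = (- (1))%C).
  { replace w with ((1 + w) - 1)%C by ring. rewrite E. ring. }
  rewrite Ew, Cmod_m1 in Hw. lra. }
split.
- replace ((P + T) / P)%C with (1 + w)%C by (unfold w; field; exact HP0).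
  rewrite re_plus, re_RtoC.
  pose proof (re_le_Cmod w) as H. apply Rabs_le_between in H. lra.
- assert (HPR : (P + T)%C <> 0%C).
  { replace (P + T)%C with (P * (1 + w))%C by (unfold w; field; exact HP0).
    apply Cmult_neq_0; assumption. }
  replace (P / (P + T))%C with (/ (1 + w))%C.
  + eapply Rle_trans; [| apply (Re_inv_one_plus_ge w); lra].
    pose proof (Cmod_ge_0 w).
    apply Rmult_le_compat_l; [lra |]. apply Rinv_le_contravar; lra.
  + unfold w. field. repeat split; auto.
Qed.
(** * The coefficient series *)

Lemma square_le_pow2 (n : nat) : INR (n + 2) ^ 2 <= 9 * 2 ^ n.
Proof.
destruct n as [|n]; [simpl; lra |].
induction n as [|n IH]; [simpl; lra |].
replace (INR (S (S n) + 2)) with (INR (S n + 2) + 1) by (rewrite <- S_INR; reflexivity).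
assert (H : 3 <= INR (S n + 2)).
{ replace 3 with (INR 3) by (simpl; lra). apply le_INR. lia. }
rewrite <- (tech_pow_Rmult 2 (S n)). nra.
Qed.

(** As [beta + 1 >= 4] beats the factor [2^n] lost to the weight, the terms are
    at most [3 / 2^n]. *)
Lemma ex_series_square_weighted (beta : R) (c : nat -> R) :
  3 <= beta ->
  (forall n, 0 <= c (S n) <= 1 / (beta * (beta + 1) ^ n)) ->
  ex_series (fun n => Rabs (c n) * INR (n + 1) ^ 2).
Proof.
intros Hb Hc.
apply ex_series_incr_1.
apply (ex_series_le (K := R_AbsRing) (V := R_CompleteNormedModule) _
         (fun n => 3 * (1 / 2) ^ n)).
- intros n.
  change (Rabs (Rabs (c (S n)) * INR (S n + 1) ^ 2) <= 3 * (1 / 2) ^ n).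
  destruct (Hc n) as [Hc0 Hc1].
  rewrite (Rabs_pos_eq (c (S n))) by exact Hc0.
  rewrite Rabs_pos_eq by (apply Rmult_le_pos; [exact Hc0 | apply pow2_ge_0]).
  replace (S n + 1)%nat with (n + 2)%nat by lia.
  apply Rle_trans with (1 / (3 * 4 ^ n) * (9 * 2 ^ n)).
  + apply Rmult_le_compat; [exact Hc0 | apply pow2_ge_0 | | apply square_le_pow2].
    eapply Rle_trans; [exact Hc1 |].
    apply Rmult_le_compat_l; [lra |].
    assert (0 < 4 ^ n) by (apply pow_lt; lra).
    assert (4 ^ n <= (beta + 1) ^ n) by (apply pow_incr; lra).
    apply Rinv_le_contravar; nra.
  + right. replace 4 with (2 * 2) by ring. unfold Rdiv.
    rewrite !Rpow_mult_distr, pow1, pow_inv. field. apply pow_nonzero. lra.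
- apply (ex_series_scal (V := R_NormedModule) 3).
  apply ex_series_geom. rewrite Rabs_pos_eq; lra.
Qed.

(** The value on the right is the sum of the whole series. *)
Lemma sum_n_weighted_le (beta : R) (N : nat) :
  0 < beta ->
  sum_n (fun n => 1 / (beta * (beta + 1) ^ n) * INR (n + 2)) N
    <= (2 * beta ^ 2 + 3 * beta + 1) / beta ^ 3.
Proof.
intros Hb.
(* [u n] is the tail of the series from index [n] on, found by solving
   [term n = u n - u (n + 1)] with [u n = (c n + d) / (beta + 1) ^ n]. *)
set (u := fun n => ((beta + 1) / beta ^ 2 * INR n
                    + (2 * beta ^ 2 + 3 * beta + 1) / beta ^ 3) / (beta + 1) ^ n).
assert (Hstep : forall n, 1 / (beta * (beta + 1) ^ n) * INR (n + 2) = u n - u (S n)).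
{ intros n. unfold u. rewrite plus_INR, (S_INR n). simpl. field.
  repeat split; try apply pow_nonzero; lra. }
assert (Hsum : sum_n (fun n => 1 / (beta * (beta + 1) ^ n) * INR (n + 2)) N
  = u 0%nat - u (S N)).
{ induction N as [|N IH].
  - rewrite sum_O. apply Hstep.
  - rewrite sum_Sn, IH, Hstep. change plus with Rplus. simpl. ring. }
assert (H0 : u 0%nat = (2 * beta ^ 2 + 3 * beta + 1) / beta ^ 3)
  by (unfold u; simpl; field; lra).
assert (HN : 0 <= u (S N)).
{ unfold u. apply Rdiv_le_0_compat; [| apply pow_lt; lra].
  apply Rplus_le_le_0_compat.
  - apply Rmult_le_pos; [| apply pos_INR].
    apply Rdiv_le_0_compat; [lra | apply pow_lt; lra].
  - apply Rdiv_le_0_compat; [nra | apply pow_lt; lra]. }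
rewrite Hsum, H0. lra.
Qed.

Lemma ex_series_weighted (beta : R) (c : nat -> R) :
  3 <= beta ->
  (forall n, 0 <= c (S n) <= 1 / (beta * (beta + 1) ^ n)) ->
  ex_series (fun n => c (S n) * INR (n + 2)).
Proof.
intros Hb Hc.
pose proof (ex_series_square_weighted beta c Hb Hc) as H.
apply ex_series_incr_1 in H.
apply (ex_series_le (K := R_AbsRing) (V := R_CompleteNormedModule) _ _) with (2 := H).
intros n. change (Rabs (c (S n) * INR (n + 2)) <= Rabs (c (S n)) * INR (S n + 1) ^ 2).
replace (S n + 1)%nat with (n + 2)%nat by lia.
rewrite Rabs_mult. apply Rmult_le_compat_l; [apply Rabs_pos |].
rewrite Rabs_pos_eq by apply pos_INR.
assert (1 <= INR (n + 2)) by (replace 1 with (INR 1) by reflexivity; apply le_INR; lia).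
nra.
Qed.

Lemma Series_weighted_le (beta : R) (c : nat -> R) :
  3 <= beta ->
  (forall n, 0 <= c (S n) <= 1 / (beta * (beta + 1) ^ n)) ->
  Series (fun n => c (S n) * INR (n + 2)) <= (2 * beta ^ 2 + 3 * beta + 1) / beta ^ 3.
Proof.
intros Hb Hc.
set (M := (2 * beta ^ 2 + 3 * beta + 1) / beta ^ 3).
assert (H : is_lim_seq (sum_n (fun n => c (S n) * INR (n + 2)))
              (Series (fun n => c (S n) * INR (n + 2))))
  by apply (Series_correct _ (ex_series_weighted beta c Hb Hc)).
change (Rbar_le (Series (fun n => c (S n) * INR (n + 2))) M).
refine (is_lim_seq_le _ (fun _ => M) _ M _ H _).
- intros N. eapply Rle_trans; [| apply (sum_n_weighted_le beta N); lra].
  apply sum_n_m_le. intros n.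
  apply Rmult_le_compat_r; [apply pos_INR | apply Hc].
- apply is_lim_seq_const.
Qed.

(** The bound concerns the series without its constant term, which for the
    partial sum is the 1 that keeps the derivative away from 0. *)
Lemma derivative_series (beta : R) (c : nat -> R) (z : C) :
  3 <= beta ->
  (forall n, 0 <= c (S n) <= 1 / (beta * (beta + 1) ^ n)) ->
  Cmod z < 1 ->
  exists l : C, is_series (fun n => (c n * INR (n + 1) * z ^ n)%C) l /\
    Cmod (l - c 0%nat) <= Series (fun n => c (S n) * INR (n + 2)).
Proof.
intros Hb Hc Hz.
pose proof (ex_series_weighted beta c Hb Hc) as Hex.
assert (Hle : forall n,
  Cmod (c (S n) * INR (S n + 1) * z ^ S n)%C <= c (S n) * INR (n + 2)).
{ intros n. replace (S n + 1)%nat with (n + 2)%nat by lia.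
  rewrite !Cmod_mult, !Cmod_R.
  rewrite !Rabs_pos_eq by (apply pos_INR || apply Hc).
  rewrite <- (Rmult_1_r (c (S n) * INR (n + 2))) at 2.
  apply Rmult_le_compat_l.
  - apply Rmult_le_pos; [apply Hc | apply pos_INR].
  - apply Cmod_pow_le_1. lra. }
assert (Hl : exists l0 : C,
  is_series (fun n => (c (S n) * INR (S n + 1) * z ^ S n)%C) l0)
  by exact (ex_series_le (V := C_CompleteNormedModule) _ _ Hle Hex).
destruct Hl as [l0 Hl0].
exists (l0 + c 0%nat)%C. split.
- apply (is_series_decr_1 (V := C_NormedModule)).
  replace (plus _ _) with (l0 : C_NormedModule); [exact Hl0 |].
  change (l0 = l0 + c 0%nat + - (c 0%nat * 1 * 1))%C. ring.
- replace (l0 + c 0%nat - c 0%nat)%C with l0 by ring.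
  apply (is_series_Cmod_le _ _ _ Hl0 Hle Hex).
Qed.

Lemma is_series_finite_support (a : nat -> C) (m : nat) :
  (forall n, (m < n)%nat -> a n = RtoC 0) -> is_series a (sum_n a m).
Proof.
intros Ha.
apply (filterlim_ext_loc (fun _ => sum_n a m)).
- exists m. intros n Hn.
  induction Hn as [|n Hn IH]; [reflexivity |].
  rewrite sum_Sn, <- IH, (Ha (S n)) by lia.
  symmetry. apply (plus_zero_r (G := C_AbelianMonoid)).
- apply filterlim_const.
Qed.

(** * The Mittag-Leffler function and its partial sums *)

(** Truncated coefficients make the partial sum a power series too, so that it
    and the full series are differentiated and estimated by the same lemmas. *)
Definition truncate (m : nat) (a : nat -> R) (n : nat) : R :=
  if (n <=? m)%nat then a n else 0.

Lemma is_series_ML (alpha beta : R) (z : C) :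
  1 <= alpha -> 3 <= beta -> Cmod z < 1 ->
  is_series (fun n => (ML_coef alpha beta n * z ^ (n + 1))%C) (ML alpha beta z).
Proof.
intros Ha Hb Hz.
assert (Hc : forall n, 0 <= ML_coef alpha beta (S n) <= 1 / (beta * (beta + 1) ^ n))
  by (intros n; apply ML_coef_bounds; lra).
assert (Hle : forall n,
  Cmod (ML_term alpha beta z (S n)) <= ML_coef alpha beta (S n) * INR (n + 2)).
{ intros n. unfold ML_term. rewrite Cmod_mult, Cmod_R, Rabs_pos_eq by apply Hc.
  apply Rmult_le_compat_l; [apply Hc |].
  apply Rle_trans with 1; [apply Cmod_pow_le_1; lra |].
  replace 1 with (INR 1) by reflexivity. apply le_INR. lia. }
assert (Hl : exists l : C, is_series (fun n => ML_term alpha beta z (S n)) l)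
  by exact (ex_series_le (V := C_CompleteNormedModule) _ _ Hle
              (ex_series_weighted beta (ML_coef alpha beta) Hb Hc)).
destruct Hl as [l Hl].
unfold ML. rewrite (C_Series_unique _ l Hl).
apply (is_series_decr_1 (V := C_NormedModule)).
replace (plus _ _) with (l : C_NormedModule); [exact Hl |].
rewrite ML_coef_0 by lra.
change (l = z + l + - (1 * (z * 1)))%C. ring.
Qed.

Lemma is_series_ML_partial (alpha beta : R) (m : nat) (z : C) :
  2 <= beta ->
  is_series (fun n => (truncate m (ML_coef alpha beta) n * z ^ (n + 1))%C)
    (ML_partial alpha beta m z).
Proof.
intros Hb.
replace (ML_partial alpha beta m z)
  with (sum_n (fun n => (truncate m (ML_coef alpha beta) n * z ^ (n + 1))%C) m).
- apply is_series_finite_support. intros n Hn. unfold truncate.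
  rewrite (proj2 (Nat.leb_gt n m) Hn). ring.
- unfold sum_n, ML_partial. rewrite sum_Sn_m by lia.
  change plus with Cplus. f_equal.
  + unfold truncate. simpl. rewrite ML_coef_0 by exact Hb. ring.
  + apply sum_n_m_ext_loc. intros n [_ Hn]. unfold truncate, ML_term.
    rewrite (proj2 (Nat.leb_le n m) Hn). reflexivity.
Qed.

Lemma threshold_bounds (beta : R) :
  (3 + sqrt 17) / 2 <= beta -> 3 <= beta /\ 0 <= beta ^ 2 - 3 * beta - 2.
Proof.
intros Hb.
assert (H17 : sqrt 17 * sqrt 17 = 17) by (apply sqrt_sqrt; lra).
pose proof (sqrt_pos 17) as Hs.
assert (3 <= sqrt 17) by nra.
split; nra.
Qed.

(* [C_derive f z] is the complex derivative of [f] whenever [f] is complex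
   differentiable at [z] ([is_C_derive_unique]). *)
Theorem theorem2p2 (alpha beta : R) (m : nat) (z : C)
    (halpha : 1 <= alpha)
    (hbeta : (3 + sqrt 17) / 2 <= beta)
    (hz : Cmod z < 1) :
  Re (C_derive (ML alpha beta) z / C_derive (ML_partial alpha beta m) z)%C
    >= (beta ^ 2 - 3 * beta - 2) / beta ^ 2
  /\
  Re (C_derive (ML_partial alpha beta m) z / C_derive (ML alpha beta) z)%C
    >= beta ^ 2 / (beta ^ 2 + 3 * beta + 2).
Proof.
destruct (threshold_bounds beta hbeta) as [Hb Hq].
set (a := ML_coef alpha beta).
set (p := truncate m a).
set (r := fun n => a n - p n).
set (B := fun n => 1 / (beta * (beta + 1) ^ n)).
assert (Ha : forall n, 0 <= a (S n) <= B n)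
  by (intros n; apply ML_coef_bounds; lra).
assert (Hp : forall n, 0 <= p (S n) <= B n).
{ intros n. specialize (Ha n). unfold p, truncate. destruct (S n <=? m)%nat; lra. }
assert (Hr : forall n, 0 <= r (S n) <= B n).
{ intros n. specialize (Ha n). unfold r, p, truncate. destruct (S n <=? m)%nat; lra. }
assert (Hp0 : p 0%nat = 1) by (apply (ML_coef_0 alpha beta); lra).
assert (Hr0 : r 0%nat = 0) by (apply Rminus_diag_eq; reflexivity).
destruct (derivative_series beta p z Hb Hp hz) as (P & HP & HPle).
destruct (derivative_series beta r z Hb Hr hz) as (T & HT & HTle).
assert (DP : C_derive (ML_partial alpha beta m) z = P).
{ apply is_C_derive_unique, (is_C_derive_power_series p); [| | exact hz | exact HP].
  - apply (ex_series_square_weighted beta p Hb Hp).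
  - intros w _. apply is_series_ML_partial. lra. }
assert (DQ : C_derive (ML alpha beta) z = (P + T)%C).
{ apply is_C_derive_unique, (is_C_derive_power_series a); [| | exact hz |].
  - apply (ex_series_square_weighted beta a Hb Ha).
  - intros w Hw. apply is_series_ML; assumption || lra.
  - eapply is_series_ext; [| apply (is_series_plus (V := C_NormedModule) _ _ _ _ HP HT)].
    intros n. unfold r. rewrite RtoC_minus. change plus with Cplus. simpl. ring. }
rewrite DP, DQ.
rewrite Hp0 in HPle. rewrite Hr0 in HTle.
replace (T - 0)%C with T in HTle by ring.
assert (Hsum :
  Series (fun n => p (S n) * INR (n + 2)) + Series (fun n => r (S n) * INR (n + 2))
   < (3 * beta + 2) / beta ^ 2).
{ rewrite <- Series_plus by (apply (ex_series_weighted beta); assumption).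
  rewrite (Series_ext _ (fun n => a (S n) * INR (n + 2)))
    by (intros n; unfold r; ring).
  eapply Rle_lt_trans; [apply (Series_weighted_le beta a Hb Ha) |].
  assert (Hd : (3 * beta + 2) / beta ^ 2 - (2 * beta ^ 2 + 3 * beta + 1) / beta ^ 3
     = (beta ^ 2 - beta - 1) / beta ^ 3) by (field; lra).
  assert (0 < (beta ^ 2 - beta - 1) / beta ^ 3)
    by (apply Rdiv_lt_0_compat; [nra | apply pow_lt; lra]).
  lra. }
assert (Hsig : 1 - (3 * beta + 2) / beta ^ 2 = (beta ^ 2 - 3 * beta - 2) / beta ^ 2)
  by (field; lra).
assert (Hsig1 : 0 <= (beta ^ 2 - 3 * beta - 2) / beta ^ 2)
  by (apply Rdiv_le_0_compat; [exact Hq | apply pow_lt; lra]).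
destruct (quotient_Re_bounds P T _ _ _ HPle HTle Hsum) as [H1 H2]; [lra |].
split; apply Rle_ge.
- lra.
- replace (beta ^ 2 / (beta ^ 2 + 3 * beta + 2))
    with (1 / (1 + (3 * beta + 2) / beta ^ 2)); [exact H2 |].
  field. split; nra.
Qed.
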